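(* Let $\hat f$ be a minimizer over $f$ of $\mathbb{E}_x\mathbb{E}_{u\sim D_x}[g_u(\hat w(f(x)))]$ and let $f^*$ be a minimizer over $f$ of $\mathbb{E}_x\mathbb{E}_{u\sim D_x}[g_u(w^*(f(x)))]$, both minimizations being over the same class $\mathcal{F}$ of forecasting models. Then $$\mathbb{E}_{x}\mathbb{E}_{u\sim D_x}\left[g_{u}(w^*(\hat f(x))) - g_{u}(w^*(f^*(x)))\right] \leq \epsilon_1+\epsilon_2,$$ where $$\epsilon_1=\mathbb{E}_x\mathbb{E}_{u\sim D_x}\left|g_{u}(w^*(f^*(x)))-g_{u}(\hat w(f^*(x)))\right|,\qquad \epsilon_2=\mathbb{E}_x\mathbb{E}_{u\sim D_x}\left|g_{u}(w^*(\hat f(x)))-g_{u}(\hat w(\hat f(x)))\right|.$$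
   Context: For each value $u\in\mathbb{R}^d$ of an uncertain parameter, $g_u(w)$ is a real-valued convex objective function of a decision $w$, and $\mathcal{P}$ is the convex feasible region of decisions. The map $w^*$ sends a parameter $u$ to an exact solution $w^*(u)\in\arg\min_{w\in\mathcal{P}}g_u(w)$. The map $\hat w$ is any other map from parameters to decisions (an approximation of $w^*$). Features $x\in\mathbb{R}^p$ are random, and $D_x$ is the distribution of $u$ conditioned on observing features $x$. A forecasting model is a function $f$ sending features $x$ to a predicted parameter $f(x)\in\mathbb{R}^d$. The minimizers $\hat f$ and $f^*$ are assumed to exist, and all expectations appearing are assumed to be finite. *)

(* Defs.v *)
From HB Require Import structures.
From mathcomp Require Import all_boot all_order all_algebra.
From mathcomp Require Import all_classical all_reals all_analysis.

Set Implicit Arguments.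
Unset Strict Implicit.
Unset Printing Implicit Defensive.

Import Order.TTheory GRing.Theory Num.Theory.

Local Open Scope classical_set_scope.
Local Open Scope ring_scope.
Local Open Scope ereal_scope.

Definition is_minimizer {disp : Order.disp_t} {T : Type} {V : porderType disp}
    (A : set T) (h : T -> V) (a : T) : Prop :=
  A a /\ forall b, A b -> (h a <= h b)%O.

Section iterated_expectation.
Context {dX dU : measure_display} {X : measurableType dX}
  {U : measurableType dU} {R : realType}.

(* [E_x E_{u ~ D_x} [h x u]], where [P] is the law of [x] and the probability
   kernel [D] is the conditional law of [u] given [x]. *)
Definition iterE (P : probability X R) (D : R.-pker X ~> U)
    (h : X -> U -> R) : \bar R :=
  \int[P]_x \int[D x]_u (h x u)%:E.

(* Both integrals of [iterE P D h] exist and are finite. Joint measurability of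
   [h] is not required; when [h] is integrable for the joint law of [(x, u)],
   this holds by Fubini's theorem. *)
Definition iterE_finite (P : probability X R) (D : R.-pker X ~> U)
    (h : X -> U -> R) : Prop :=
  {ae P, forall x, (D x).-integrable setT (fun u => (h x u)%:E)} /\
  P.-integrable setT (fun x => \int[D x]_u (h x u)%:E).

End iterated_expectation.

(* Main.v *)
Require Import Defs.
From HB Require Import structures.
From mathcomp Require Import all_boot all_order all_algebra.
From mathcomp Require Import all_classical all_reals all_analysis.
From mathcomp Require Import measurable_realfun.

Set Implicit Arguments.
Unset Strict Implicit.
Unset Printing Implicit Defensive.

Import Order.TTheory GRing.Theory Num.Theory.

Local Open Scope classical_set_scope.
Local Open Scope ring_scope.

(* Almost everywhere, w*(fhat) costs at most |w*(fhat) - what(fhat)| more than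
   what(fhat), which on average is no worse than what(fstar), which in turn costs
   at most |w*(fstar) - what(fstar)| more than w*(fstar). Since integrands such
   as x |-> E_{u ~ D_x} (h x u - k x u) agree with a measurable function only
   almost everywhere, monotonicity of the integral is needed for functions that
   are not assumed measurable. *)

Section integral_nonmeasurable.
Import HBNNSimple.
Local Open Scope ereal_scope.
Context d (T : measurableType d) (R : realType).
Variable mu : {measure set T -> \bar R}.

(* The integral of a nonnegative function is a supremum over the simple functions
   below it, and restricting these to the complement of a null set changes
   nothing; hence no measurability is needed. *)
Lemma ge0_ae_le_integralT (f g : T -> \bar R) :
  (forall x, 0 <= f x) -> (forall x, 0 <= g x) ->
  {ae mu, forall x, f x <= g x} -> \int[mu]_x f x <= \int[mu]_x g x.
Proof.
move=> f0 g0 [N [mN N0 fgN]].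
rewrite [leLHS]ge0_integralE// [leRHS]ge0_integralE// !patch_setT.
apply: ge_ereal_sup => _ [h /= hf <-].
have mNC : measurable (~` N) by exact: measurableC.
have -> : sintegral mu h = sintegral mu (proj_nnsfun h mNC).
  rewrite -!integralT_nnsfun; apply: ge0_ae_eq_integral => //.
  - exact/measurable_EFinP.
  - exact/measurable_EFinP.
  - by move=> x _; rewrite lee_fin.
  - by move=> x _; rewrite lee_fin.
  - exists N; split => // x /= xN; apply: contrapT => Nx; apply: xN => _.
    by rewrite mindicE mem_set//= mulr1.
(* The truncated function competes in the supremum for [g]: on [N] it is 0, and off [N] it equals
   [h], with [h <= f <= g]. *)
apply: ereal_sup_ubound; exists (proj_nnsfun h mNC) => //= x.
rewrite mindicE; have [/set_mem Nx|_] := boolP (x \in ~` N); last by rewrite mulr0.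
rewrite mulr1; apply: le_trans (hf x) _.
by apply: contrapT => fg; apply: Nx; exact: fgN.
Qed.

(** The integral is that of the positive part minus that of the negative part; the first part grows
    with the function and the second shrinks. *)
Lemma ae_le_integralT (f g : T -> \bar R) :
  {ae mu, forall x, f x <= g x} -> \int[mu]_x f x <= \int[mu]_x g x.
Proof.
move=> fg; rewrite [leLHS]integralE [leRHS]integralE leeB//.
- apply: ge0_ae_le_integralT => //.
  by apply: filterS fg => x fgx; rewrite !funeposE ge_max !le_max fgx lexx orbT.
- apply: ge0_ae_le_integralT => //.
  by apply: filterS fg => x fgx; rewrite !funenegE ge_max !le_max leeN2 fgx lexx orbT.
Qed.

Lemma le_integralT (f g : T -> \bar R) :
  (forall x, f x <= g x) -> \int[mu]_x f x <= \int[mu]_x g x.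
Proof. by move=> fg; apply: ae_le_integralT; exact: aeW. Qed.

Lemma ae_eq_integralT (f g : T -> \bar R) :
  {ae mu, forall x, f x = g x} -> \int[mu]_x f x = \int[mu]_x g x.
Proof.
move=> fg; apply/eqP; rewrite eq_le; apply/andP; split;
  by apply: ae_le_integralT; apply: filterS fg => x ->.
Qed.

End integral_nonmeasurable.

Section iterE_theory.
Local Open Scope ereal_scope.
Context {dX dU : measure_display} {X : measurableType dX}
  {U : measurableType dU} {R : realType}.
Variables (P : probability X R) (D : R.-pker X ~> U).
Implicit Types h k : X -> U -> R.

Lemma iterE_fin_num h : iterE_finite P D h -> iterE P D h \is a fin_num.
Proof. by case=> _ ih; exact: integrable_fin_num. Qed.

Lemma le_iterE h k : (forall x u, (h x u <= k x u)%R) ->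
  iterE P D h <= iterE P D k.
Proof.
by move=> hk; apply: le_integralT => x; apply: le_integralT => u; rewrite lee_fin.
Qed.

(** Additivity of the outer integral leaves an identity between inner integrals. It is known only at
    the almost all [x] where both integrands are integrable for [D x], which suffices by
    [ae_eq_integralT]. *)
Lemma iterED h k : iterE_finite P D h -> iterE_finite P D k ->
  iterE P D (fun x u => h x u + k x u)%R = iterE P D h + iterE P D k.
Proof.
move=> [aeh ih] [aek ik]; rewrite /iterE -integralD//.
apply: ae_eq_integralT; apply: filterS2 aeh aek => x hx kx.
by under eq_integral do rewrite EFinD; rewrite integralD.
Qed.

Lemma iterEB h k : iterE_finite P D h -> iterE_finite P D k ->
  iterE P D (fun x u => h x u - k x u)%R = iterE P D h - iterE P D k.
Proof.
move=> [aeh ih] [aek ik]; rewrite /iterE -integralB//.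
apply: ae_eq_integralT; apply: filterS2 aeh aek => x hx kx.
by under eq_integral do rewrite EFinB; rewrite integralB.
Qed.

End iterE_theory.

Theorem theorem1 (R : realType) (p d : nat) (W : lmodType R)
  (Px : probability (p.-tuple R) R)
  (D : R.-pker (p.-tuple R) ~> (d.-tuple R))
  (g : d.-tuple R -> W -> R) (feas : set W)
  (wstar what : d.-tuple R -> W)
  (F : set (p.-tuple R -> d.-tuple R))
  (fhat fstar : p.-tuple R -> d.-tuple R)
  (feas_convex : convex_set feas)
  (g_convex : forall u, convex_function feas (g u))
  (wstar_argmin : forall u, is_minimizer feas (g u) (wstar u))
  (what_finite : forall f, F f ->
     iterE_finite Px D (fun x u => g u (what (f x))))
  (wstar_finite : forall f, F f ->
     iterE_finite Px D (fun x u => g u (wstar (f x))))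
  (eps1_finite : iterE_finite Px D
     (fun x u => `|g u (wstar (fstar x)) - g u (what (fstar x))|))
  (eps2_finite : iterE_finite Px D
     (fun x u => `|g u (wstar (fhat x)) - g u (what (fhat x))|))
  (fhat_min : is_minimizer F
     (fun f => iterE Px D (fun x u => g u (what (f x)))) fhat)
  (fstar_min : is_minimizer F
     (fun f => iterE Px D (fun x u => g u (wstar (f x)))) fstar) :
  let eps1 := iterE Px D
    (fun x u => `|g u (wstar (fstar x)) - g u (what (fstar x))|) in
  let eps2 := iterE Px D
    (fun x u => `|g u (wstar (fhat x)) - g u (what (fhat x))|) in
  (iterE Px D (fun x u => (g u (wstar (fhat x)) - g u (wstar (fstar x)))%R)
     <= eps1 + eps2)%E.
Proof.
cbv zeta; set eps1 := (X in (_ <= X + _)%E); set eps2 := (X in (_ <= _ + X)%E).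
have [Ffhat minhat] := fhat_min; have [Ffstar _] := fstar_min.
have whF := what_finite _ Ffhat; have wsF := what_finite _ Ffstar.
have shF := wstar_finite _ Ffhat; have ssF := wstar_finite _ Ffstar.
have le2 : (iterE Px D (fun x u => g u (wstar (fhat x))) <=
    iterE Px D (fun x u => g u (what (fhat x))) + eps2)%E.
  rewrite -iterED//; apply: le_iterE => x u.
  by rewrite -lerBlDl ler_norm.
have le1 : (iterE Px D (fun x u => g u (what (fstar x))) <=
    iterE Px D (fun x u => g u (wstar (fstar x))) + eps1)%E.
  rewrite -iterED//; apply: le_iterE => x u.
  (* Here [what] comes first in the difference, whereas [eps1] has [wstar] first; hence [distrC]. *)
  by rewrite -lerBlDl distrC ler_norm.
(* The subtracted expectation is finite, so it can move to the right. After [le2] the term [eps2]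
   cancels, and the minimality of [fhat] tested at [fstar], then [le1], closes the chain. *)
rewrite iterEB// leeBlDr ?iterE_fin_num//.
apply: (le_trans le2); rewrite (addeAC eps1) leeD2r// addeC.
exact: le_trans (minhat _ Ffstar) le1.
Qed.
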